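(* Let $(\mathfrak{g},\phi_\mathfrak{g})$ be a LeibDer pair and $(\mathfrak{a},\phi_\mathfrak{a})$ an abelian LeibDer pair. Then the isomorphism classes of central extensions of $(\mathfrak{g},\phi_\mathfrak{g})$ by $(\mathfrak{a},\phi_\mathfrak{a})$ are classified by the second cohomology group $H^2_{\mathrm{LeibDer}}(\mathfrak{g},\mathfrak{a})$ of $(\mathfrak{g},\phi_\mathfrak{g})$ with coefficients in the trivial representation $(\mathfrak{a},\phi_\mathfrak{a})$; that is, assigning to a central extension the cohomology class of the 2-cocycle $(\psi,\chi)$ obtained from a section induces a bijection between the set of isomorphism classes of central extensions and $H^2_{\mathrm{LeibDer}}(\mathfrak{g},\mathfrak{a})$.
   Context: All vector spaces and linear maps are over a field $\mathbb{K}$ of characteristic zero. A (right) Leibniz algebra is a vector space $\mathfrak{g}$ with a bilinear bracket satisfying $[[x,y],z]=[[x,z],y]+[x,[y,z]]$. A LeibDer pair $(\mathfrak{g},\phi_\mathfrak{g})$ is a Leibniz algebra with a derivation $\phi_\mathfrak{g}$ ($\phi_\mathfrak{g}[x,y]=[\phi_\mathfrak{g}(x),y]+[x,\phi_\mathfrak{g}(y)]$). A morphism $(\mathfrak{g},\phi_\mathfrak{g})\to(\mathfrak{h},\phi_\mathfrak{h})$ is a Leibniz algebra morphism $f$ with $\phi_\mathfrak{h}\circ f=f\circ\phi_\mathfrak{g}$; it is an isomorphism if $f$ is bijective. A LeibDer pair is abelian if its Leibniz bracket is zero. A central extension of $(\mathfrak{g},\phi_\mathfrak{g})$ by $(\mathfrak{a},\phi_\mathfrak{a})$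 is an exact sequence of LeibDer pairs $0\to(\mathfrak{a},\phi_\mathfrak{a})\xrightarrow{i}(\mathfrak{h},\phi_\mathfrak{h})\xrightarrow{p}(\mathfrak{g},\phi_\mathfrak{g})\to0$ with $[i(a),h]=0=[h,i(a)]$ for all $a\in\mathfrak{a},h\in\mathfrak{h}$. Two central extensions $(\mathfrak{h},\phi_\mathfrak{h})$, $(\mathfrak{h}',\phi_{\mathfrak{h}'})$ are isomorphic if there is a LeibDer pair isomorphism $\eta:\mathfrak{h}\to\mathfrak{h}'$ with $\eta\circ i=i'$ and $p'\circ\eta=p$. A section of $p$ is a linear map $s:\mathfrak{g}\to\mathfrak{h}$ with $p\circ s=\mathrm{id}_\mathfrak{g}$. Identifying $\mathfrak{a}$ with $i(\mathfrak{a})$, a section $s$ gives maps $\psi(x,y)=[s(x),s(y)]-s[x,y]\in\mathfrak{a}$ and $\chi(x)=\phi_\mathfrak{h}(s(x))-s(\phi_\mathfrak{g}(x))\in\mathfrak{a}$; the pair $(\psi,\chi)$ is a 2-cocycle whose class does not depend on $s$. Cohomology with coefficients in the trivial representation $(\mathfrak{a},\phi_\mathfrak{a})$ (all actions of $\mathfrak{g}$ on $\mathfrak{a}$ are zero): for $f\in\mathrm{Hom}(\mathfrak{g}^{\otimes n},\mathfrak{a})$, $$(\delta_Lf)(x_1,\ldots,x_{n+1})=\sum_{i<j}(-1)^{j+1}f(x_1,\ldots,x_{i-1},[x_i,x_j],x_{i+1},\ldots,\widehat{x_j},\ldots,x_{n+1}),$$ $$\delta f=\sum_{i=1}^nf\circ(\mathrm{id}\otimes\cdots\otimes\phi_\mathfrak{g}\otimes\cdots\otimes\mathrm{id})-\phi_\mathfrak{a}\circ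 f\quad(\phi_\mathfrak{g}\text{ in the }i\text{-th place}).$$ Put $C^0_{\mathrm{LeibDer}}=0$, $C^1_{\mathrm{LeibDer}}(\mathfrak{g},\mathfrak{a})=\mathrm{Hom}(\mathfrak{g},\mathfrak{a})$, $C^n_{\mathrm{LeibDer}}(\mathfrak{g},\mathfrak{a})=\mathrm{Hom}(\mathfrak{g}^{\otimes n},\mathfrak{a})\times\mathrm{Hom}(\mathfrak{g}^{\otimes n-1},\mathfrak{a})$ for $n\ge2$, with differential $\partial f=(\delta_Lf,-\delta f)$ for $f\in C^1_{\mathrm{LeibDer}}$ and $\partial(f_n,\overline f_n)=(\delta_Lf_n,\delta_L\overline f_n+(-1)^n\delta f_n)$ for $n\ge2$. $H^n_{\mathrm{LeibDer}}(\mathfrak{g},\mathfrak{a})$ is the $n$-th cohomology of this complex. *)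

(* Defs.v *)
From HB Require Import structures.
From mathcomp Require Import all_boot all_algebra.
From mathcomp Require Import boolp functions.

Set Implicit Arguments.
Unset Strict Implicit.
Unset Printing Implicit Defensive.

Import GRing.Theory.
Local Open Scope ring_scope.
Local Open Scope quotient_scope.

Reserved Notation "⟦ x , y ⟧" (format "⟦ x ,  y ⟧").

Record leibnizAlg (K : fieldType) := LeibnizAlg {
  leibniz_sort :> lmodType K;
  bracket : {bilinear leibniz_sort -> leibniz_sort -> leibniz_sort};
  bracket_leibniz : forall x y z : leibniz_sort,
    bracket (bracket x y) z = bracket (bracket x z) y + bracket x (bracket y z)
}.

Notation "⟦ x , y ⟧" := (bracket _ x y) : ring_scope.

Definition derivation (K : fieldType) (g : leibnizAlg K)
    (phi : {linear g -> g}) : Prop :=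
  forall x y : g, phi ⟦x, y⟧ = ⟦phi x, y⟧ + ⟦x, phi y⟧.

Record leibDer (K : fieldType) := LeibDer {
  leibDer_alg :> leibnizAlg K;
  der : {linear leibDer_alg -> leibDer_alg};
  der_derivation : derivation der
}.

Definition abelian_leibDer (K : fieldType) (a : leibDer K) : Prop :=
  forall x y : a, ⟦x, y⟧ = 0.

Definition leibDer_morphism (K : fieldType) (g h : leibDer K)
    (f : {linear g -> h}) : Prop :=
  (forall x y : g, f ⟦x, y⟧ = ⟦f x, f y⟧) /\
  (forall x : g, der h (f x) = f (der g x)).

Record centralExt (K : fieldType) (g a : leibDer K) := CentralExt {
  ext_pair :> leibDer K;
  ext_inj : {linear a -> ext_pair};
  ext_proj : {linear ext_pair -> g};
  ext_inj_morphism : leibDer_morphism ext_inj;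
  ext_proj_morphism : leibDer_morphism ext_proj;
  ext_inj_injective : injective ext_inj;
  ext_exact : forall h : ext_pair, ext_proj h = 0 <-> exists u : a, ext_inj u = h;
  ext_proj_surjective : forall x : g, exists h : ext_pair, ext_proj h = x;
  ext_central : forall (u : a) (h : ext_pair),
    ⟦ext_inj u, h⟧ = 0 /\ ⟦h, ext_inj u⟧ = 0
}.

Definition ext_iso (K : fieldType) (g a : leibDer K) (E E' : centralExt g a) :
    Prop :=
  exists eta : {linear E -> E'},
    [/\ leibDer_morphism eta, bijective eta,
        forall u : a, eta (ext_inj E u) = ext_inj E' u &
        forall h : E, ext_proj E' (eta h) = ext_proj E h].

Section ExtensionClasses.
Variables (K : fieldType) (g a : leibDer K).

Lemma ext_iso_refl (E : centralExt g a) : ext_iso E E.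
Proof. by exists idfun; split=> //; exists id. Qed.

Lemma ext_iso_sym (E E' : centralExt g a) : ext_iso E E' -> ext_iso E' E.
Proof.
case=> eta [[etaB etaD] [ite etaK iteK] etai etap].
have ite_linear : linear ite.
  by move=> c u v; rewrite -[LHS]etaK -[RHS]etaK linearP !iteK.
pose ite_lin : {linear E' -> E} := HB.pack ite (GRing.isLinear.Build _ _ _ _ ite ite_linear).
exists ite_lin; split.
- split=> [x y|x] /=.
    by apply: (can_inj etaK); rewrite etaB !iteK.
  by apply: (can_inj etaK); rewrite -etaD !iteK.
- by exists eta.
- by move=> u /=; rewrite -etai etaK.
- by move=> h /=; rewrite -etap iteK.
Qed.

Lemma ext_iso_trans (E E' E'' : centralExt g a) :
  ext_iso E E' -> ext_iso E' E'' -> ext_iso E E''.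
Proof.
case=> u [[uB uD] ubij ui up] [v [[vB vD] vbij vi vp]].
exists (v \o u); split=> /=.
- by split=> [x y|x] /=; rewrite ?uB ?vB // vD uD.
- exact: bij_comp.
- by move=> w; rewrite ui vi.
- by move=> h; rewrite vp up.
Qed.

(* Isomorphism classes. The generic quotients need a choiceType, and universe  *)
(* levels forbid such a structure on centralExt, whose elements carry a        *)
(* lmodType; hence the classes are saturated predicates.                       *)
Record ext_classes := ExtClasses {
  ext_class_pred : centralExt g a -> Prop;
  ext_class_pred_ex : exists E : centralExt g a, ext_class_pred = ext_iso E
}.

Definition ext_class (E : centralExt g a) : ext_classes :=
  @ExtClasses (ext_iso E) (ex_intro _ E erefl).

Lemma ext_class_eq (E E' : centralExt g a) :
  ext_class E = ext_class E' <-> ext_iso E E'.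
Proof.
split=> [[->]|EE']; first exact: ext_iso_refl.
have eqEE' : ext_iso E = ext_iso E'.
  apply/funext => F; apply/propext; split; last exact: ext_iso_trans.
  exact/ext_iso_trans/ext_iso_sym.
rewrite /ext_class; move: (ex_intro _ E _) (ex_intro _ E' _).
by rewrite eqEE' => p q; congr ExtClasses; apply: Prop_irrelevance.
Qed.

Lemma ext_class_surj (c : ext_classes) : exists E, ext_class E = c.
Proof.
case: c => P [E PE]; exists E; rewrite /ext_class; subst P.
by congr ExtClasses; apply: Prop_irrelevance.
Qed.

End ExtensionClasses.

Section Homology.
Variables (K : fieldType) (A B C : lmodType K).
Variables (f : {linear A -> B}) (g : {linear B -> C}).

Definition is_cycle : {pred B} := fun z => g z == 0.

Lemma is_cycle_submod_closed : submod_closed is_cycle.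
Proof.
split=> [|c x y]; rewrite !unfold_in ?linear0 // => /eqP gx /eqP gy.
by rewrite linearP gx gy scaler0 addr0.
Qed.

HB.instance Definition _ :=
  GRing.isSubmodClosed.Build K B is_cycle is_cycle_submod_closed.

Definition cycles := {z : B | is_cycle z}.

HB.instance Definition _ := Choice.on cycles.
HB.instance Definition _ := SubChoice.on cycles.
HB.instance Definition _ := [SubChoice_isSubLmodule of cycles by <:].

Definition is_boundary : {pred cycles} :=
  fun z => `[< exists x : A, f x = val z >].

Lemma is_boundary_zmod_closed : zmod_closed is_boundary.
Proof.
split=> [|z w].
  by apply/asboolP; exists 0; rewrite !linear0.
move=> /asboolP [x fx] /asboolP [y fy]; apply/asboolP; exists (x - y).
by rewrite linearB fx fy.
Qed.

HB.instance Definition _ :=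
  GRing.isZmodClosed.Build cycles is_boundary is_boundary_zmod_closed.

(* Ker g / (Im f :&: Ker g), i.e. Ker g / Im f as soon as g \o f = 0. *)
Definition homology : zmodType := Quotient.quot is_boundary.

Definition homology_class (z : cycles) : homology :=
  \pi_(Quotient.quot is_boundary) z.

End Homology.

Definition update (T : Type) (n : nat) (x : 'I_n -> T) (i : 'I_n) (v : T) :
    'I_n -> T :=
  fun j => if j == i then v else x j.

Section Multilinear.
Variables (K : fieldType) (V W : lmodType K) (n : nat).

Definition multilinear (f : ('I_n -> V) -> W) : Prop :=
  forall (x : 'I_n -> V) (i : 'I_n), linear (fun v => f (update x i v)).

Definition multilinearb : {pred ('I_n -> V) -> W} :=
  fun f => `[< multilinear f >].

Lemma multilinearb_submod_closed : submod_closed multilinearb.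
Proof.
split=> [|c f h /asboolP fl /asboolP hl]; apply/asboolP.
  by move=> x i k u v; rewrite scaler0 addr0.
move=> x i k u v; rewrite !addrfctE !scalrfctE fl hl !scalerDr !scalerA.
by rewrite mulrC addrACA.
Qed.

HB.instance Definition _ :=
  GRing.isSubmodClosed.Build K _ multilinearb multilinearb_submod_closed.

(* Hom(V^{\otimes n}, W), represented by n-linear maps. *)
Record multimap := MultiMap {
  multimap_fun :> ('I_n -> V) -> W;
  multimap_mem : multimap_fun \in multilinearb
}.

HB.instance Definition _ := [isSub for multimap_fun].
HB.instance Definition _ := [Choice of multimap by <:].
HB.instance Definition _ := [SubChoice_isSubLmodule of multimap by <:].

Lemma multimapP (f : multimap) : multilinear f.
Proof. exact/asboolP/multimap_mem. Qed.

Lemma multimap_ext (f h : multimap) : f =1 h -> f = h.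
Proof. by move=> fh; apply/val_inj/funext. Qed.

Lemma multimap_linE (c : K) (f h : multimap) (x : 'I_n -> V) :
  (c *: f + h) x = c *: f x + h x.
Proof. by []. Qed.

End Multilinear.

Section Complex.
Variables (K : fieldType) (g a : leibDer K).

Local Notation Hom n := (multimap g a n).

(* (x_1, ..., [x_i, x_j], ..., \hat{x_j}, ..., x_{n+1}) *)
Definition contract (n : nat) (x : 'I_n.+1 -> g) (i j : 'I_n.+1) : 'I_n -> g :=
  fun k => update x i ⟦x i, x j⟧ (lift j k).

(* Ordinals count from 0: the sign (-1)^(j+1) of the usual 1-based formula is *)
(* (-1)^(j+2) here.                                                          *)
Definition deltaL_fun (n : nat) (f : Hom n) (x : 'I_n.+1 -> g) : a :=
  \sum_(i < n.+1) \sum_(j < n.+1 | (i < j)%N)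
    (-1) ^+ j.+2 *: f (contract x i j).

Definition delta_fun (n : nat) (f : Hom n) (x : 'I_n -> g) : a :=
  \sum_(i < n) f (update x i (der g (x i))) - der a (f x).

Lemma contract_linear n (f : Hom n) (x : 'I_n.+1 -> g) (i j k : 'I_n.+1) :
  i != j -> linear (fun v => f (contract (update x k v) i j)).
Proof.
move=> ij; have [ki kiE] : exists ki, i = lift j ki.
  by case: (unliftP j i) ij => [ki -> _|->]; [exists ki | rewrite eqxx].
case: (unliftP j k) => [k' ->|->].
  have [<-|nki] := eqVneq i (lift j k').
    have E v : contract (update x i v) i j = update (contract x i j) ki ⟦v, x j⟧.
      apply/funext => l; rewrite /contract /update !eqxx (eq_sym j) (negPf ij).
      have -> : (lift j l == i) = (l == ki) by rewrite kiE (inj_eq lift_inj).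
      by case: (l == ki).
    by move=> c u v; rewrite !E linearPl multimapP.
  have E v : contract (update x (lift j k') v) i j = update (contract x i j) k' v.
    apply/funext => l; rewrite /contract /update (negPf nki).
    rewrite (negPf (neq_lift j k')) !(inj_eq lift_inj).
    case: (eqVneq (lift j l) i) => // li; case: eqVneq => // lk.
    by move: nki; rewrite -li lk eqxx.
  by move=> c u v; rewrite !E multimapP.
have E v : contract (update x j v) i j = update (contract x i j) ki ⟦x i, v⟧.
  apply/funext => l; rewrite /contract /update !eqxx (negPf ij).
  have -> : (lift j l == i) = (l == ki) by rewrite kiE (inj_eq lift_inj).
  by rewrite (eq_sym _ j) (negPf (neq_lift j l)); case: (l == ki).
by move=> c u v; rewrite !E linearPr multimapP.
Qed.

Lemma deltaL_multilinear n (f : Hom n) : deltaL_fun f \in @multilinearb K g a n.+1.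
Proof.
apply/asboolP => x k c u v; rewrite /deltaL_fun scaler_sumr -big_split /=.
apply: eq_bigr => i _; rewrite scaler_sumr -big_split /=.
apply: eq_bigr => j ij; rewrite contract_linear; last by rewrite neq_ltn ij.
by rewrite scalerDr !scalerA mulrC.
Qed.

Lemma delta_multilinear n (f : Hom n) : delta_fun f \in @multilinearb K g a n.
Proof.
apply/asboolP => x k c u v; rewrite /delta_fun scalerBr addrACA -opprD.
rewrite multimapP linearP scaler_sumr -big_split /=; congr (_ - _).
apply: eq_bigr => i _; have [->|ik] := eqVneq i k.
  have E w : update (update x k w) k (der g (update x k w k))
             = update x k (der g w).
    by apply/funext => l; rewrite /update eqxx; case: (l == k).
  by rewrite !E linearP multimapP.
have E w : update (update x k w) i (der g (update x k w i))
           = update (update x i (der g (x i))) k w.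
  apply/funext => l; rewrite /update (negPf ik); case: eqVneq => // ->.
  by rewrite (negPf ik).
by rewrite !E multimapP.
Qed.

Definition deltaL (n : nat) (f : Hom n) : Hom n.+1 :=
  MultiMap (deltaL_multilinear f).

Definition delta (n : nat) (f : Hom n) : Hom n := MultiMap (delta_multilinear f).

Lemma deltaL_linear n : linear (@deltaL n).
Proof.
move=> c f h; apply: multimap_ext => x.
rewrite multimap_linE /= /deltaL_fun scaler_sumr -big_split /=.
apply: eq_bigr => i _; rewrite scaler_sumr -big_split /=; apply: eq_bigr => j _.
rewrite -[X in _ *: X = _]/(c *: f (contract x i j) + h (contract x i j)).
by rewrite scalerDr !scalerA mulrC.
Qed.

HB.instance Definition _ n :=
  GRing.isLinear.Build K (Hom n) (Hom n.+1) _ (@deltaL n) (@deltaL_linear n).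

Lemma delta_linear n : linear (@delta n).
Proof.
move=> c f h; apply: multimap_ext => x.
rewrite multimap_linE /= /delta_fun scalerBr addrACA -opprD.
rewrite -[X in der a X]/(c *: f x + h x) linearP.
by rewrite scaler_sumr -big_split.
Qed.

HB.instance Definition _ n :=
  GRing.isLinear.Build K (Hom n) (Hom n) _ (@delta n) (@delta_linear n).

Definition cochain (n : nat) : lmodType K :=
  match n with
  | 0 => 'rV[K]_0
  | 1 => Hom 1
  | m.+2 => (Hom m.+2 * Hom m.+1)%type
  end.

Definition diff1 (f : Hom 1) : Hom 2 * Hom 1 := (deltaL f, - delta f).

Definition diff2 (m : nat) (f : Hom m.+2 * Hom m.+1) : Hom m.+3 * Hom m.+2 :=
  (deltaL f.1, deltaL f.2 + (-1) ^+ m.+2 *: delta f.1).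

Lemma diff1_linear : linear diff1.
Proof.
move=> c f h; rewrite /diff1; congr pair; first exact: linearP.
by rewrite [delta _]linearP opprD -scalerN.
Qed.

HB.instance Definition _ :=
  GRing.isLinear.Build K (Hom 1) (Hom 2 * Hom 1)%type _ diff1 diff1_linear.

Lemma diff2_linear m : linear (@diff2 m).
Proof.
move=> c f h; rewrite /diff2; congr pair; first exact: linearP.
rewrite [deltaL _]linearP [delta _]linearP /= !scalerDr !scalerA.
by rewrite [_ ^+ _ * c]mulrC addrACA.
Qed.

HB.instance Definition _ m :=
  GRing.isLinear.Build K (Hom m.+2 * Hom m.+1)%type (Hom m.+3 * Hom m.+2)%type _
    (@diff2 m) (@diff2_linear m).

Definition coboundary (n : nat) : {linear cochain n -> cochain n.+1} :=
  match n with
  | 0 => \0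
  | 1 => diff1
  | m.+2 => @diff2 m
  end.

Definition cocycle (n : nat) : lmodType K := cycles (coboundary n).

Definition cohomology (n : nat) : zmodType :=
  match n with
  | 0 => homology (\0 : {linear 'rV[K]_0 -> cochain 0}) (coboundary 0)
  | m.+1 => homology (coboundary m) (coboundary m.+1)
  end.

Definition cohomology_class (m : nat) (z : cocycle m.+1) : cohomology m.+1 :=
  homology_class (coboundary m) z.

End Complex.

Definition is_section (K : fieldType) (g a : leibDer K) (E : centralExt g a)
    (s : {linear g -> E}) : Prop :=
  forall x : g, ext_proj E (s x) = x.

(* c = (psi, chi), with a identified with its image under ext_inj; since       *)
(* ext_inj is injective, s determines c.                                       *)
Definition section_cochain (K : fieldType) (g a : leibDer K) (E : centralExt g a)
    (s : {linear g -> E}) (c : cochain g a 2) : Prop :=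
  (forall x : 'I_2 -> g, ext_inj E (c.1 x) =
     ⟦s (x ord0), s (x ord_max)⟧ - s ⟦x ord0, x ord_max⟧) /\
  (forall x : 'I_1 -> g, ext_inj E (c.2 x) =
     der E (s (x ord0)) - s (der g (x ord0))).

(* Main.v *)
From HB Require Import structures.
Require Import Defs.
From mathcomp Require Import all_boot all_algebra.
From mathcomp Require Import boolp classical_sets.

Set Implicit Arguments.
Unset Strict Implicit.
Unset Printing Implicit Defensive.

Import GRing.Theory.
Local Open Scope ring_scope.

(** The theorem holds because a central extension is determined by what its
    bracket and derivation look like in coordinates. Fix a section s of p; it
    exists, since a surjective linear map splits, in any dimension, by Zorn's
    lemma (surjective_linear_section). Every element of the extension is then
    s x + i u for a unique pair (x, u), and, i a being central,

      [s x + i u, s y + i v] = s [x, y] + i (psi (x, y)),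
      phi (s x + i u) = s (phi x) + i (chi x + phi u).

    In these coordinates, the Leibniz identity and the derivation property
    of the extension say exactly that (psi, chi) is a 2-cocycle (cocycle2P).
    This gives three facts.

    - Well-definedness: two sections differ by a linear map f from g to a, and
      replacing s by s + i f adds the coboundary of f to (psi, chi)
      (shift_section, section_cochain_cohomologous). An isomorphism of
      extensions carries sections to sections with the same cocycle
      (ext_iso_section).

    - Injectivity: extensions with sections that have the same cocycle are
      isomorphic, by identifying coordinates (ext_iso_of_cochain); if the
      cocycles are only cohomologous, one first moves one of the sections.

    - Surjectivity: for a 2-cocycle, the two formulas above define a central
      extension on g * a (twisted_ext).

    The first two facts combine into ext_iso_cohomology_class: extensions are
    isomorphic if and only if the classes of their cocycles agree. *)

(** * Splitting surjective linear maps *)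

(** Zorn's lemma yields a maximal subspace U that meets the kernel of p
    trivially. Maximality forces p to be onto already on U, so p restricts to
    a bijection from U to W, whose inverse is the section. *)
Lemma surjective_linear_section (K : fieldType) (V W : lmodType K)
    (p : {linear V -> W}) :
  (forall w, exists v, p v = w) ->
  exists s : {linear W -> V}, forall w, p (s w) = w.
Proof.
move=> p_surj.
(* The empty set is good too, as it must be to bound the empty chain; hence
   the separate argument that U contains 0. *)
pose good (U : set V) := (forall c u v, U u -> U v -> U (c *: u + v)) /\
  (forall u, U u -> p u = 0 -> u = 0).
have [F Fgood Ftot|U [[Ulin Uker] Umax]] := @Zorn_bigcup V good.
  split=> [c u v [X FX Xu] [Y FY Yv]|u [X FX Xu]]; last exact: (Fgood X FX).2.
  have [XY|YX] := Ftot X Y FX FY.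
    by exists Y => //; apply: (Fgood Y FY).1 => //; exact: XY.
  by exists X => //; apply: (Fgood X FX).1 => //; exact: YX.
have U0 : U 0.
  apply: contrapT => nU0.
  apply: (Umax [set 0]%classic).
    split=> [u Uu|/(_ 0 erefl)//].
    by case: nU0; have := Ulin (-1) u u Uu Uu; rewrite scaleN1r addNr.
  by split=> [c u v -> ->|u ->//]; rewrite scaler0 addr0.
have UZ c u : U u -> U (c *: u).
  by move=> Uu; have := Ulin c u 0 Uu U0; rewrite addr0.
have U_onto w : exists u, U u /\ p u = w.
  apply: contrapT => nUw; have [v pv] := p_surj w.
  apply: (Umax [set h | exists u c, U u /\ h = u + c *: v]%classic).
    split=> [u Uu|sub]; first by exists u, 0; rewrite scale0r addr0.
    apply: nUw; exists v; split=> //; apply: sub.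
    by exists 0, 1; rewrite scale1r add0r.
  split=> [d _ _ [u [c [Uu ->]]] [u' [c' [Uu' ->]]]|_ [u [c [Uu ->]]]].
    exists (d *: u + u'), (d * c + c'); split; first exact: Ulin.
    by rewrite scalerDr scalerDl scalerA addrACA.
  rewrite linearD linearZ /= pv => puw.
  have [c0|c_neq0] := eqVneq c 0.
    move: puw; rewrite c0 !scale0r !addr0; exact: Uker.
  (* c is nonzero and p u = - c *: w, so w is the image of a point of U. *)
  case: nUw; exists (- c^-1 *: u); split; first exact: UZ.
  move/eqP: puw; rewrite addr_eq0 => /eqP puw.
  by rewrite linearZ /= puw scalerN scaleNr opprK scalerA mulVf // scale1r.
have [s sP] := choice U_onto.
have s_linear : linear s.
  move=> c x y; have [Ux px] := sP x; have [Uy py] := sP y.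
  have [Uxy pxy] := sP (c *: x + y).
  apply: subr0_eq; apply: Uker.
    by rewrite -scaleN1r [X in U X]addrC; apply: (Ulin) => //; exact: Ulin.
  by rewrite linearB linearP /= pxy px py subrr.
pose s_lin : {linear W -> V} :=
  HB.pack s (GRing.isLinear.Build _ _ _ _ s s_linear).
by exists s_lin => w; have [] := sP w.
Qed.

Lemma linear_at0 (K : fieldType) (V W : lmodType K) (F : V -> W) :
  linear F -> F 0 = 0.
Proof. by move/(_ (-1) 0 0); rewrite !scaleN1r !addNr. Qed.

(** * Multilinear maps of arity at most three *)

Section Args.
Variables (K : fieldType) (V W : lmodType K).

(** Turns an explicit list of arguments into the function on ordinals that a
    multilinear map expects. The length of the list is meant to be n; positions
    beyond its end would get the default value 0. *)
Definition args (n : nat) (s : seq V) : 'I_n -> V := fun i => s`_i.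

Lemma args1 (x : 'I_1 -> V) : x = args [:: x ord0].
Proof. by apply/funext => i; rewrite ord1. Qed.

Lemma args2 (x : 'I_2 -> V) : x = args [:: x ord0; x ord_max].
Proof.
by apply/funext => -[[|[|//]] ?]; rewrite /args /=; congr x; apply: val_inj.
Qed.

Lemma args3 (x : 'I_3 -> V) :
  x = args [:: x ord0; x (lift ord0 ord0); x ord_max].
Proof.
by apply/funext => -[[|[|[|//]]] ?]; rewrite /args /=; congr x; apply: val_inj.
Qed.

Lemma linear_args1 (f : multimap V W 1) : linear (fun x => f (args [:: x])).
Proof.
move=> c x y; have := multimapP f (args [:: 0]) ord0 c x y.
have E v : update (args [:: 0]) ord0 v = args [:: v] :> ('I_1 -> V).
  by apply/funext => -[[|//] ?].
by rewrite !E.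
Qed.

Lemma linear_args2l (f : multimap V W 2) y :
  linear (fun x => f (args [:: x; y])).
Proof.
move=> c u v; have := multimapP f (args [:: 0; y]) ord0 c u v.
have E w : update (args [:: 0; y]) ord0 w = args [:: w; y] :> ('I_2 -> V).
  by apply/funext => -[[|[|//]] ?].
by rewrite !E.
Qed.

Lemma linear_args2r (f : multimap V W 2) x :
  linear (fun y => f (args [:: x; y])).
Proof.
move=> c u v; have := multimapP f (args [:: x; 0]) ord_max c u v.
have E w : update (args [:: x; 0]) ord_max w = args [:: x; w] :> ('I_2 -> V).
  by apply/funext => -[[|[|//]] ?].
by rewrite !E.
Qed.

End Args.

(** * The complex in degrees one and two *)

Section LowDegree.
Variables (K : fieldType) (g a : leibDer K).

Lemma deltaL1E (f : multimap g a 1) x y :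
  deltaL f (args [:: x; y]) = - f (args [:: ⟦x, y⟧]).
Proof.
rewrite /= /deltaL_fun; under eq_bigr do rewrite big_mkcond.
rewrite !big_ord_recl !big_ord0 /= ?(addr0, add0r).
rewrite /bump /= !exprS expr0 !mulN1r !opprK scaleN1r.
by congr (- f _); apply/funext => -[[|//] ?].
Qed.

Lemma delta1E (f : multimap g a 1) x :
  delta f (args [:: x]) = f (args [:: der g x]) - der a (f (args [:: x])).
Proof.
rewrite /= /delta_fun big_ord_recl big_ord0 addr0.
by congr (f _ - _); apply/funext => -[[|//] ?].
Qed.

Lemma deltaL2E (f : multimap g a 2) x y z :
  deltaL f (args [:: x; y; z]) =
  - f (args [:: ⟦x, y⟧; z]) + f (args [:: ⟦x, z⟧; y])
  + f (args [:: x; ⟦y, z⟧]).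
Proof.
rewrite /= /deltaL_fun; under eq_bigr do rewrite big_mkcond.
rewrite !big_ord_recl !big_ord0 /= ?(addr0, add0r).
rewrite /bump /= !exprS expr0 !mulN1r !opprK !scaleN1r !scale1r.
by congr (- f _ + f _ + f _); apply/funext => -[[|[|//]] ?].
Qed.

Lemma delta2E (f : multimap g a 2) x y :
  delta f (args [:: x; y]) =
  f (args [:: der g x; y]) + f (args [:: x; der g y])
  - der a (f (args [:: x; y])).
Proof.
rewrite /= /delta_fun !big_ord_recl big_ord0 addr0.
by congr (f _ + f _ - _); apply/funext => -[[|[|//]] ?].
Qed.

(** The first equation is the obstruction to the Leibniz identity, the second
    the obstruction to the derivation property, of the structure that c defines
    on g * a. *)
Lemma cocycle2P (c : cochain g a 2) :
  is_cycle (coboundary g a 2) c <->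
  (forall x y z, c.1 (args [:: ⟦x, y⟧; z]) =
     c.1 (args [:: ⟦x, z⟧; y]) + c.1 (args [:: x; ⟦y, z⟧])) /\
  (forall x y, c.2 (args [:: ⟦x, y⟧]) + der a (c.1 (args [:: x; y])) =
     c.1 (args [:: der g x; y]) + c.1 (args [:: x; der g y])).
Proof.
split=> [/eqP[psiE chiE]|[psiE chiE]].
  split=> [x y z|x y].
    have := congr1 (@^~ (args [:: x; y; z])) psiE.
    rewrite -[LHS]/(deltaL c.1 _) deltaL2E => /eqP.
    by rewrite -addrA addrC subr_eq0 => /eqP.
  have := congr1 (@^~ (args [:: x; y])) chiE.
  rewrite -[LHS]/(deltaL c.2 (args _) + (-1) ^+ 2 *: delta c.1 (args _)).
  rewrite deltaL1E delta2E sqrrN expr1n scale1r => /eqP.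
  by rewrite addrA subr_eq0 addrC subr_eq => /eqP ->; rewrite addrC.
apply/eqP; congr pair; apply: multimap_ext => x.
  rewrite (args3 x) -[LHS]/(deltaL c.1 _) deltaL2E psiE.
  by rewrite -addrA addNr.
rewrite (args2 x).
rewrite -[LHS]/(deltaL c.2 (args _) + (-1) ^+ 2 *: delta c.1 (args _)).
rewrite deltaL1E delta2E sqrrN expr1n scale1r -chiE.
by rewrite addrK addNr.
Qed.

Lemma add_diff1_fst (c : cochain g a 2) (f : multimap g a 1) x y :
  (c + diff1 f).1 (args [:: x; y]) =
  c.1 (args [:: x; y]) - f (args [:: ⟦x, y⟧]).
Proof. by rewrite -deltaL1E. Qed.

Lemma add_diff1_snd (c : cochain g a 2) (f : multimap g a 1) x :
  (c + diff1 f).2 (args [:: x]) =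
  c.2 (args [:: x]) + der a (f (args [:: x])) - f (args [:: der g x]).
Proof. by rewrite -addrA -opprB -delta1E. Qed.

(** The quotient is by the cocycles in the image of the coboundary, so equality
    of classes is a bare existence statement about a 1-cochain. *)
Lemma cohomology_class_eq (z w : cocycle g a 2) :
  cohomology_class z = cohomology_class w <->
  exists f : multimap g a 1, diff1 f = sval z - sval w.
Proof.
rewrite /cohomology_class /homology_class; split=> [zw|[f fE]].
  have : z - w \in @is_boundary _ _ _ _ (coboundary g a 1) (coboundary g a 2).
    by rewrite Quotient.idealrBE; apply/eqP.
  by move=> /asboolP[f fE]; exists f.
by apply/eqP; rewrite -Quotient.idealrBE; apply/asboolP; exists f.
Qed.

Lemma cohomology_class_surj (w : cohomology g a 2) :
  exists z : cocycle g a 2, cohomology_class z = w.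
Proof. by exists (repr w); exact: reprK. Qed.

End LowDegree.

(** * Sections of a central extension and their cocycles *)

Section Extensions.
Variables (K : fieldType) (g a : leibDer K).

Local Notation i := (ext_inj _).
Local Notation p := (ext_proj _).

Section OneExtension.
Variable E : centralExt g a.

Lemma ext_proj_inj u : ext_proj E (i u) = 0.
Proof. by apply/ext_exact; exists u. Qed.

(** Centrality makes the bracket insensitive to the components in a. *)
Lemma bracket_inj (h k : E) u v : ⟦h + i u, k + i v⟧ = ⟦h, k⟧.
Proof.
rewrite linearDl linearDr /=.
have [-> _] := ext_central u (k + i v); have [_ ->] := ext_central v h.
by rewrite !addr0.
Qed.

Lemma lift_to_kernel (T : Type) (F : T -> E) :
  (forall t, p (F t) = 0) -> exists f : T -> a, forall t, i (f t) = F t.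
Proof.
move=> pF; have /choice[f fE] t : exists u, i u = F t by apply/ext_exact.
by exists f.
Qed.

(** By exactness and injectivity of i, a map into E that p kills is a map into
    a; multilinearity passes to it because i is linear and injective. *)
Lemma lift_multimap n (F : multimap g E n) :
  (forall x, p (F x) = 0) -> exists f : multimap g a n, forall x, i (f x) = F x.
Proof.
move=> /lift_to_kernel[f fE].
have f_lin : f \in @multilinearb K g a n.
  apply/asboolP => x k c u v; apply: (@ext_inj_injective _ _ _ E).
  by rewrite linearP /= !fE multimapP.
by exists (MultiMap f_lin).
Qed.

Implicit Types s t : {linear g -> E}.

(** A section splits E, as a vector space, into g and a; r is the projection
    onto a. *)
Lemma section_decomp s : is_section s ->
  exists r : E -> a, (forall h, h = s (p h) + i (r h)) /\
    forall x u, r (s x + i u) = u.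
Proof.
move=> sP; have [h|r rE] := @lift_to_kernel E (fun h => h - s (p h)).
  by rewrite linearB /= sP subrr.
exists r; split=> [h|x u]; first by rewrite rE addrC subrK.
apply: (@ext_inj_injective _ _ _ E); rewrite rE linearD /= ext_proj_inj addr0.
by rewrite sP addrAC subrr add0r.
Qed.

Lemma section_cochain_bracket s (c : cochain g a 2) x y u v :
  section_cochain s c ->
  ⟦s x + i u, s y + i v⟧ = s ⟦x, y⟧ + i (c.1 (args [:: x; y])).
Proof. by move=> [cE _]; rewrite bracket_inj cE addrC subrK. Qed.

Lemma section_cochain_der s (c : cochain g a 2) x u : section_cochain s c ->
  der E (s x + i u) = s (der g x) + i (c.2 (args [:: x]) + der a u).
Proof.
move=> [_ cE]; rewrite !linearD /= cE (ext_inj_morphism E).2.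
by rewrite addrA [s _ + _]addrC subrK.
Qed.

Lemma section_cochain_intro s (c : cochain g a 2) :
  (forall x y, ⟦s x, s y⟧ = s ⟦x, y⟧ + i (c.1 (args [:: x; y]))) ->
  (forall x, der E (s x) = s (der g x) + i (c.2 (args [:: x]))) ->
  section_cochain s c.
Proof.
move=> psiE chiE; split=> x.
  by rewrite {1}(args2 x) psiE addrAC subrr add0r.
by rewrite {1}(args1 x) chiE addrAC subrr add0r.
Qed.

Lemma section_decomp_inj s x y u v : is_section s ->
  s x + i u = s y + i v -> x = y /\ u = v.
Proof.
move=> sP e; have xy : x = y.
  by have := congr1 p e; rewrite !linearD /= !ext_proj_inj !addr0 !sP.
by move: e; rewrite xy => /addrI /ext_inj_injective.
Qed.

Lemma section_cochain_exists s : is_section s ->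
  exists c : cochain g a 2, section_cochain s c.
Proof.
move=> sP.
pose F (x : 'I_2 -> g) := ⟦s (x ord0), s (x ord_max)⟧ - s ⟦x ord0, x ord_max⟧.
pose G (x : 'I_1 -> g) := der E (s (x ord0)) - s (der g (x ord0)).
have F_lin : F \in @multilinearb K g E 2.
  apply/asboolP => x [[|[|//]] ?] c u v; rewrite /F /update /=.
    by rewrite !(linearP, linearPl) /= scalerDr addrACA.
  by rewrite !(linearP, linearPr) /= scalerDr addrACA.
have G_lin : G \in @multilinearb K g E 1.
  apply/asboolP => x [[|//] ?] c u v; rewrite /G /update /=.
  by rewrite !linearP /= scalerDr addrACA.
have [x|psi psiE] := @lift_multimap 2 (MultiMap F_lin).
  by rewrite /= /F linearB /= (ext_proj_morphism E).1 !sP subrr.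
have [x|chi chiE] := @lift_multimap 1 (MultiMap G_lin).
  by rewrite /= /G linearB /= -(ext_proj_morphism E).2 !sP subrr.
by exists (psi, chi).
Qed.

(** Evaluate the Leibniz identity of E on three values of s, and the derivation
    property on two: the a-components of both sides are the cocycle
    equations. *)
Lemma section_cochain_cocycle s (c : cochain g a 2) : is_section s ->
  section_cochain s c -> is_cycle (coboundary g a 2) c.
Proof.
move=> sP cP; have B := section_cochain_bracket _ _ _ _ cP.
have B0 x y : ⟦s x, s y⟧ = s ⟦x, y⟧ + i (c.1 (args [:: x; y])).
  by have := B x y 0 0; rewrite linear0 !addr0.
have D x : der E (s x) = s (der g x) + i (c.2 (args [:: x])).
  by have := section_cochain_der x 0 cP; rewrite !linear0 !addr0.
apply/cocycle2P; split=> [x y z|x y].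
  have := bracket_leibniz (s x) (s y) (s z); rewrite !B0.
  (* Put bare values of s in the form s x + i 0, so that every bracket is in
     coordinates. *)
  rewrite -[s z]addr0 -[s y]addr0 -[s x]addr0 -(linear0 (ext_inj E)) !B.
  by rewrite addrACA -!linearD => /(section_decomp_inj sP)[].
have := der_derivation (s x) (s y); rewrite !B0 !D (section_cochain_der _ _ cP).
rewrite -[s y]addr0 -[s x]addr0 -(linear0 (ext_inj E)) !B.
by rewrite addrACA -!linearD => /(section_decomp_inj sP)[].
Qed.

(** Adding i f to a section leaves the bracket of its values unchanged, but
    moves s [x, y] by f [x, y]; in the same way chi moves by
    phi f - f phi. These changes are the two components of diff1 f. *)
Lemma shift_section s (c : cochain g a 2) (f : multimap g a 1) : is_section s ->
  section_cochain s c ->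
  exists t : {linear g -> E},
    [/\ is_section t, forall x, t x = s x + i (f (args [:: x])) &
        section_cochain t (c + diff1 f)].
Proof.
move=> sP cP; pose t0 x := s x + i (f (args [:: x])).
have t0_lin : linear t0.
  by move=> k x y; rewrite /t0 linear_args1 !linearP /= scalerDr addrACA.
pose t : {linear g -> E} := HB.pack t0 (GRing.isLinear.Build _ _ _ _ t0 t0_lin).
exists t; split=> //.
  by move=> x; rewrite /t /= /t0 linearD /= sP ext_proj_inj addr0.
have tE x : t x = s x + i (f (args [:: x])) by [].
apply: section_cochain_intro => [x y|x]; rewrite !tE.
  rewrite (section_cochain_bracket _ _ _ _ cP) add_diff1_fst -addrA -linearD.
  by rewrite [f _ + _]addrC addrNK.
rewrite (section_cochain_der _ _ cP) add_diff1_snd -addrA -linearD.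
by rewrite [f _ + _]addrC addrNK.
Qed.

(** The difference of two sections is killed by p, hence is i f for a linear f;
    so the second section is the shift of the first one by f. *)
Lemma section_cochain_cohomologous s t (c d : cochain g a 2) :
  is_section s -> is_section t -> section_cochain s c -> section_cochain t d ->
  exists f : multimap g a 1, diff1 f = d - c.
Proof.
move=> sP tP cP dP.
pose F (x : 'I_1 -> g) := t (x ord0) - s (x ord0).
have F_lin : F \in @multilinearb K g E 1.
  apply/asboolP => x [[|//] ?] k u v; rewrite /F /update /=.
  by rewrite !linearP /= scalerDr addrACA.
have [x|f fE] := @lift_multimap 1 (MultiMap F_lin).
  by rewrite /= /F linearB /= sP tP subrr.
have tE x : t x = s x + i (f (args [:: x])).
  by rewrite fE /= /F /args addrC subrK.
exists f; apply/eqP; rewrite eq_sym subr_eq; apply/eqP.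
have [t' [_ t'E [psiE chiE]]] := shift_section f sP cP.
have tt' x : t x = t' x by rewrite tE t'E.
rewrite [LHS]surjective_pairing [RHS]surjective_pairing addrC.
congr pair; apply: multimap_ext => x; apply: (@ext_inj_injective _ _ _ E).
  by rewrite dP.1 !tt' -psiE.
by rewrite dP.2 !tt' -chiE.
Qed.

End OneExtension.

(** * Isomorphic extensions and cohomologous cocycles *)

(** In the coordinates given by the two sections, E and E' have the same bracket
    and derivation, so the map that identifies coordinates is an isomorphism. *)
Lemma ext_iso_of_cochain (E E' : centralExt g a) (s : {linear g -> E})
    (s' : {linear g -> E'}) (c : cochain g a 2) :
  is_section s -> is_section s' ->
  section_cochain s c -> section_cochain s' c -> ext_iso E E'.
Proof.
move=> sP s'P cP c'P.
have [r [rE rK]] := section_decomp sP.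
have [r' [r'E r'K]] := section_decomp s'P.
pose eta h := s' (p h) + i (r h).
have etaE x u : eta (s x + i u) = s' x + i u.
  by rewrite /eta rK linearD /= sP ext_proj_inj addr0.
have eta_lin : linear eta.
  move=> k h h'; rewrite {1}(rE h) {1}(rE h') scalerDr addrACA.
  rewrite -!linearZ -!linearD.
  by rewrite etaE !linearP /= scalerDr addrACA.
pose eta_l : {linear E -> E'} :=
  HB.pack eta (GRing.isLinear.Build _ _ _ _ eta eta_lin).
exists eta_l; split=> [|||h] /=.
- split=> [h k|h] /=.
    rewrite (rE h) (rE k) (section_cochain_bracket _ _ _ _ cP) !etaE.
    by rewrite (section_cochain_bracket _ _ _ _ c'P).
  rewrite (rE h) (section_cochain_der _ _ cP) !etaE.
  by rewrite (section_cochain_der _ _ c'P).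
- exists (fun h => s (p h) + i (r' h)) => h.
    by rewrite /eta r'K linearD /= s'P ext_proj_inj addr0.
  by rewrite etaE -r'E.
- by move=> u; rewrite -[i u]add0r -(linear0 s) etaE linear0 add0r.
- by rewrite /eta linearD /= s'P ext_proj_inj addr0.
Qed.

Lemma ext_iso_section (E E' : centralExt g a) (s : {linear g -> E})
    (c : cochain g a 2) :
  ext_iso E E' -> is_section s -> section_cochain s c ->
  exists2 t : {linear g -> E'}, is_section t & section_cochain t c.
Proof.
move=> [eta [[etaB etaD] _ etai etap]] sP [psiE chiE].
exists (eta \o s) => [x|]; first by rewrite /= etap.
split=> x /=; first by rewrite -etai psiE linearB /= etaB.
by rewrite -etai chiE linearB /= etaD.
Qed.

(** What makes the map to cohomology both well defined and injective on
    isomorphism classes. *)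
Lemma ext_iso_cohomology_class (E E' : centralExt g a) (s : {linear g -> E})
    (s' : {linear g -> E'}) (z z' : cocycle g a 2) :
  is_section s -> is_section s' ->
  section_cochain s (sval z) -> section_cochain s' (sval z') ->
  ext_iso E E' <-> cohomology_class z = cohomology_class z'.
Proof.
move=> sP s'P zP z'P; rewrite cohomology_class_eq; split=> [EE'|[f fE]].
  have [t tP tz] := ext_iso_section EE' sP zP.
  exact: section_cochain_cohomologous s'P tP z'P tz.
(* Shifting s' by f turns its cocycle z' into z. *)
have [t [tP _]] := shift_section f s'P z'P.
rewrite fE addrC subrK; exact: ext_iso_of_cochain sP tP zP.
Qed.

End Extensions.

(** * The extension defined by a 2-cocycle *)

Section TwistedExtension.
Variables (K : fieldType) (g a : leibDer K) (a_abelian : abelian_leibDer a).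
Variables (c : cochain g a 2) (c_cocycle : is_cycle (coboundary g a 2) c).

(** The bracket and the derivation of an extension, read in the coordinates
    (x, u) of s x + i u, with psi and chi the components of c. *)
Definition twisted_bracket_fun (h k : g * a) : g * a :=
  (⟦h.1, k.1⟧, c.1 (args [:: h.1; k.1])).

Definition twisted_der_fun (h : g * a) : g * a :=
  (der g h.1, c.2 (args [:: h.1]) + der a h.2).

Lemma twisted_bracket_bilinear :
  bilinear_for *:%R *:%R twisted_bracket_fun.
Proof.
split=> [k t h h'|h t k k']; congr pair.
- exact: linearPl.
- exact: linear_args2l.
- exact: linearPr.
- exact: linear_args2r.
Qed.

Lemma twisted_der_linear : linear twisted_der_fun.
Proof.
move=> t h k; congr pair; first exact: linearP.
by rewrite /= linear_args1 linearP scalerDr addrACA.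
Qed.

HB.instance Definition _ := bilinear_isBilinear.Build K
  (g * a)%type (g * a)%type (g * a)%type *:%R *:%R
  twisted_bracket_fun twisted_bracket_bilinear.

HB.instance Definition _ := GRing.isLinear.Build K (g * a)%type (g * a)%type _
  twisted_der_fun twisted_der_linear.

Lemma twisted_bracket_leibniz (x y z : g * a) :
  let b := twisted_bracket_fun in
  b (b x y) z = b (b x z) y + b x (b y z).
Proof.
congr pair; first exact: bracket_leibniz.
exact: ((cocycle2P c).1 c_cocycle).1.
Qed.

Definition twisted_alg : leibnizAlg K :=
  @LeibnizAlg K (g * a)%type twisted_bracket_fun twisted_bracket_leibniz.

Lemma twisted_derivation : @derivation K twisted_alg twisted_der_fun.
Proof.
move=> x y; congr pair; first exact: der_derivation.
exact: ((cocycle2P c).1 c_cocycle).2.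
Qed.

Definition twisted_leibDer : leibDer K := LeibDer twisted_derivation.

Definition twisted_inj (u : a) : twisted_leibDer := (0, u).
Definition twisted_proj (h : twisted_leibDer) : g := h.1.
Definition twisted_section (x : g) : twisted_leibDer := (x, 0).

Lemma twisted_inj_linear : linear twisted_inj.
Proof. by move=> k u v; congr pair; rewrite /= scaler0 addr0. Qed.

Lemma twisted_proj_linear : linear twisted_proj.
Proof. by []. Qed.

Lemma twisted_section_linear : linear twisted_section.
Proof. by move=> k u v; congr pair; rewrite /= scaler0 addr0. Qed.

HB.instance Definition _ :=
  GRing.isLinear.Build K a twisted_leibDer _ twisted_inj twisted_inj_linear.
HB.instance Definition _ :=
  GRing.isLinear.Build K twisted_leibDer g _ twisted_proj twisted_proj_linear.
HB.instance Definition _ :=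
  GRing.isLinear.Build K g twisted_leibDer _ twisted_section
    twisted_section_linear.

(** Here a must be abelian: the copy of a in the extension has zero bracket. *)
Lemma twisted_inj_morphism : leibDer_morphism twisted_inj.
Proof.
split=> [u v|u]; congr pair => /=.
- by rewrite linear0l.
- by rewrite (linear_at0 (linear_args2l c.1 _)) a_abelian.
- by rewrite linear0.
- by rewrite (linear_at0 (linear_args1 c.2)) add0r.
Qed.

Lemma twisted_proj_morphism : leibDer_morphism twisted_proj.
Proof. by []. Qed.

Lemma twisted_inj_injective : injective twisted_inj.
Proof. by move=> u v []. Qed.

Lemma twisted_exact (h : twisted_leibDer) :
  twisted_proj h = 0 <-> exists u, twisted_inj u = h.
Proof.
by case: h => x u; split=> [/= ->|[v [<- _]] //]; exists u.
Qed.

Lemma twisted_proj_surjective x : exists h, twisted_proj h = x.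
Proof. by exists (twisted_section x). Qed.

Lemma twisted_central u (h : twisted_leibDer) :
  ⟦twisted_inj u, h⟧ = 0 /\ ⟦h, twisted_inj u⟧ = 0.
Proof.
split; congr pair => /=; rewrite ?linear0l ?linear0r //.
  exact: linear_at0 (linear_args2l c.1 _).
exact: linear_at0 (linear_args2r c.1 _).
Qed.

Definition twisted_ext : centralExt g a :=
  CentralExt twisted_inj_morphism twisted_proj_morphism twisted_inj_injective
    twisted_exact twisted_proj_surjective twisted_central.

Lemma twisted_section_is_section :
  is_section (twisted_section : {linear g -> twisted_ext}).
Proof. by []. Qed.

Lemma twisted_section_cochain :
  section_cochain (twisted_section : {linear g -> twisted_ext}) c.
Proof.
apply: section_cochain_intro => [x y|x]; congr pair => /=.
- by rewrite addr0.
- by rewrite add0r.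
- by rewrite addr0.
- by rewrite linear0 addr0 add0r.
Qed.

End TwistedExtension.

(** * The classification *)

Theorem theorem4p4 (K : fieldType) (charK : [pchar K] =i pred0)
    (g a : leibDer K) (a_abelian : abelian_leibDer a) :
  (forall E : centralExt g a, exists s : {linear g -> E}, is_section s) /\
  (exists Phi : ext_classes g a -> cohomology g a 2,
     bijective Phi /\
     (forall (E : centralExt g a) (s : {linear g -> E}), is_section s ->
        exists2 z : cocycle g a 2,
          section_cochain s (sval z) &
          Phi (ext_class E) = cohomology_class z)).
Proof.
have section_ex (E : centralExt g a) : exists s : {linear g -> E}, is_section s.
  exact: surjective_linear_section (@ext_proj_surjective _ _ _ E).
split=> //.
have cocycle_ex (E : centralExt g a) (s : {linear g -> E}) : is_section s ->
    exists z : cocycle g a 2, section_cochain s (sval z).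
  move=> sP; have [c cP] := section_cochain_exists sP.
  by exists (exist _ c (section_cochain_cocycle sP cP)).
have Phi_ex (C : ext_classes g a) : exists w : cohomology g a 2,
    forall (E : centralExt g a) (s : {linear g -> E}) (z : cocycle g a 2),
    ext_class E = C -> is_section s -> section_cochain s (sval z) ->
    w = cohomology_class z.
  have [E <-] := ext_class_surj C.
  have [s sP] := section_ex E; have [z zP] := cocycle_ex E s sP.
  exists (cohomology_class z) => E' s' z' /esym /ext_class_eq EE' s'P z'P.
  exact/(ext_iso_cohomology_class sP s'P zP z'P).
(* The value of Phi at C is the class common to all sections of all extensions
   in C. *)
have [Phi PhiP] := choice Phi_ex.
have Phi_inj : injective Phi.
  move=> C C'; have [E <-] := ext_class_surj C.
  have [E' <-] := ext_class_surj C'.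
  have [s sP] := section_ex E; have [z zP] := cocycle_ex E s sP.
  have [s' s'P] := section_ex E'; have [z' z'P] := cocycle_ex E' s' s'P.
  rewrite (PhiP _ _ _ _ erefl sP zP) (PhiP _ _ _ _ erefl s'P z'P) => zz'.
  exact/ext_class_eq/(ext_iso_cohomology_class sP s'P zP z'P).
have Phi_surj w : exists C, Phi C = w.
  have [z <-] := cohomology_class_surj w.
  exists (ext_class (twisted_ext a_abelian (svalP z))).
  apply: PhiP erefl _ _; last exact: twisted_section_cochain.
  exact: twisted_section_is_section.
exists Phi; split=> [|E s sP].
  have [Psi PsiK] := choice Phi_surj.
  by exists Psi => // C; apply: Phi_inj; rewrite PsiK.
by have [z zP] := cocycle_ex E s sP; exists z => //; exact: PhiP erefl sP zP.
Qed.
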